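(* Let $\mathcal V_{\rm matter}$ be a vertex algebra equipped with a Hamiltonian $\widehat{\mathfrak g}_{-2h^\vee}$ action such that $\mathcal V:=C(\widehat{\mathfrak g}_{-2h^\vee},\mathfrak g,\mathcal V_{\rm matter})$ satisfies the $\mathbf Q^-\mathbf Q^+$ lemma. Then the maps $$(\mathcal V,\mathbf Q^-)\overset{i}{\longleftarrow}(\ker\mathbf Q^+,\mathbf Q^-)\overset{\pi}{\longrightarrow}(H(\mathcal V,\mathbf Q^+),(\mathbf Q^-)^* ),$$ where $i$ is the inclusion of the subcomplex $(\ker\mathbf Q^+,\mathbf Q^-)$, $\pi$ is the projection onto $\mathbf Q^+$-cohomology and $(\mathbf Q^-)^*$ is the differential induced by $\mathbf Q^-$ on $H(\mathcal V,\mathbf Q^+)$, are quasi-isomorphisms.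
   Context: Vertex algebras are over $\mathbb C$ and may have Grassmann-odd elements; $Y(x,z)=\sum_{n\in\mathbb Z}x_nz^{-n-1}$; $[\,,]$ is the graded commutator; repeated indices are summed. $\mathfrak g_c$ is the Lie algebra of a compact Lie group, $\mathfrak g=\mathfrak g_c\otimes\mathbb C$, $\{T_A\}$ a basis of $\mathfrak g_c$ with $[T_A,T_B]=f_{AB}^CT_C$, $\kappa$ a nondegenerate invariant bilinear form on $\mathfrak g_c$ restricting to the Killing form on simple factors (normalized so long roots have squared length 2), $K_{AB}=\kappa(T_A,T_B)$, $K^{AB}$ its inverse, $f_{ABC}=f^D_{AB}K_{DC}$. A Hamiltonian $\widehat{\mathfrak g}_{-2h^\vee}$ action on $\mathcal V_{\rm matter}$ is a vertex algebra homomorphism from the universal affine vertex algebra of $\mathfrak g$ (level $-2h^\vee$ for each simple factor, $0$ on the centre), $J_A(z)J_B(w)\sim\frac{kK_{AB}}{(z-w)^2}+\frac{f_{AB}^CJ_C(w)}{z-w}$; $J_A$ also denotes the images of the generators. ${\rm Sf}[\mathbb C^2\otimes\mathfrak g]$ is the vertex algebra freely generated by odd fields $\eta^{\pm,A}$ with $[\eta^{\alpha,A}_n,\eta^{\beta,B}_m]=n\epsilon^{\alpha\beta}K^{AB}\delta_{n+m,0}$, $\epsilon^{+-}=1=-\epsilon^{-+}$. $\mathfrak g$ acts on it by derivations $\theta_A:\eta^{\alpha,B}\mapsto-f_{AC}^B\eta^{\alpha,C}$. Put $$C(\widehat{\mathfrak g}_{-2h^\vee},\mathfrak g,\mathcal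 V_{\rm matter})=\{x\in\mathcal V_{\rm matter}\otimes{\rm Sf}[\mathbb C^2\otimes\mathfrak g]:(J_{A,0}+\theta_A)x=0\ \forall A\}.$$ Let $\Lambda$ be the even derivation, zero on $\mathcal V_{\rm matter}$, with $\Lambda\eta^{-,A}=\eta^{+,A}$, $\Lambda\eta^{+,A}=0$. On $C(\dots)$ there are two square-zero, mutually anticommuting odd derivations $$\mathbf Q^-=\sum_{n\ne0}\tfrac1n\eta^{-,A}_{-n}J_{A,n}+\sum_{m,n\ne0,\,m\ne n}\tfrac{f_{ABC}}{2mn}:\!\eta^{-,A}_{-n}\eta^{-,B}_m\eta^{+,C}_{n-m}\!:,\qquad\mathbf Q^+:=[\Lambda,\mathbf Q^-].$$ $\mathcal V=C(\dots)$ satisfies the $\mathbf Q^-\mathbf Q^+$ lemma if: whenever $x\in\mathcal V$ satisfies $\mathbf Q^-x=0=\mathbf Q^+x$ and ($x=\mathbf Q^-x'$ or $x=\mathbf Q^+x'$ for some $x'\in\mathcal V$), there is $\widetilde x\in\mathcal V$ with $x=\mathbf Q^-\mathbf Q^+\widetilde x$. The maps $i,\pi$ are morphisms of DG vertex algebras (vertex algebra morphisms commuting with the differentials). *)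

(* Defs.v *)
From HB Require Import structures.
From mathcomp Require Import all_boot all_order all_algebra.
From mathcomp Require Import generic_quotient complex.
From mathcomp Require Import all_classical all_reals all_analysis.

Set Implicit Arguments.
Unset Strict Implicit.
Unset Printing Implicit Defensive.

Import Order.TTheory GRing.Theory Num.Theory.
Import numFieldNormedType.Exports.

Local Open Scope classical_set_scope.
Local Open Scope ring_scope.
Local Open Scope complex_scope.

(* The binomial coefficient m (m - 1) ... (m - j + 1) / j! for any integer m. *)
Definition gbin (K : numFieldType) (m : int) (j : nat) : K :=
  (\prod_(i < j) (m - i%:Z)%:~R) / (j`!)%:R.

(* [vprod n x y] is x_n y, where Y(x, z) = \sum_n x_n z^(-n-1). The elements of
   [vpar false] (resp. [vpar true]) are the Grassmann-even (resp. odd) ones.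
   The sums over j >= 0 in the Borcherds identity are finite because of
   [vtrunc]; they are written as partial sums over j < N, N large. *)
Record vertexAlgebra (K : numFieldType) := VertexAlgebra {
  vsort :> lmodType K;
  vpar : bool -> vsort -> Prop;
  vac : vsort;
  vprod : int -> vsort -> vsort -> vsort;
  vpar0 : forall p, vpar p 0;
  vpar_linear : forall p (a : K) x y, vpar p x -> vpar p y -> vpar p (a *: x + y);
  vpar_dec : forall x, exists x0 x1,
    [/\ vpar false x0, vpar true x1 & x = x0 + x1];
  vpar_direct : forall x, vpar false x -> vpar true x -> x = 0;
  vpar_vac : vpar false vac;
  vpar_prod : forall n p q x y,
    vpar p x -> vpar q y -> vpar (p (+) q) (vprod n x y);
  vprod_linearl : forall n (a : K) x x' y,
    vprod n (a *: x + x') y = a *: vprod n x y + vprod n x' y;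
  vprod_linearr : forall n (a : K) x y y',
    vprod n x (a *: y + y') = a *: vprod n x y + vprod n x y';
  vtrunc : forall x y, exists N : int, forall n, N <= n -> vprod n x y = 0;
  vvacl : forall n y, vprod n vac y = if n == -1 then y else 0;
  vvacr : forall n x, 0 <= n -> vprod n x vac = 0;
  vvacr1 : forall x, vprod (-1) x vac = x;
  vborcherds : forall p q a b c (m n k : int), vpar p a -> vpar q b ->
    exists N0, forall N, (N0 <= N)%N ->
      \sum_(j < N) gbin K m j *:
          vprod (m + k - j%:Z) (vprod (n + j%:Z) a b) c
      = \sum_(j < N) ((-1) ^+ j * gbin K n j) *:
          (vprod (m + n - j%:Z) a (vprod (k + j%:Z) b c)
           - ((-1) ^ n * (-1) ^+ (p && q)) *:
               vprod (n + k - j%:Z) b (vprod (m + j%:Z) a c))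
}.

Arguments vac {K}.
Arguments vpar {K v}.
Arguments vprod {K v}.

Record vaHom (K : numFieldType) (V W : vertexAlgebra K) := VaHom {
  hom_fun :> V -> W;
  hom_linear : linear hom_fun;
  hom_par : forall p x, vpar p x -> vpar p (hom_fun x);
  hom_vac : hom_fun (vac V) = vac W;
  hom_prod : forall n x y,
    hom_fun (vprod n x y) = vprod n (hom_fun x) (hom_fun y)
}.

Record derivation (K : numFieldType) (V : vertexAlgebra K) (e : bool) :=
  Derivation {
  der_fun :> V -> V;
  der_linear : linear der_fun;
  der_par : forall p x, vpar p x -> vpar (e (+) p) (der_fun x);
  der_leibniz : forall n p x y, vpar p x ->
    der_fun (vprod n x y)
    = vprod n (der_fun x) y + (-1) ^+ (e && p) *: vprod n x (der_fun y)
}.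

HB.instance Definition _ (K : numFieldType) (V W : vertexAlgebra K)
  (f : vaHom V W) := GRing.isLinear.Build K V W _ (hom_fun f) (hom_linear f).
HB.instance Definition _ (K : numFieldType) (V : vertexAlgebra K) e
  (D : derivation V e) :=
  GRing.isLinear.Build K V V _ (der_fun D) (der_linear D).

Section Theory.
Variables (K : numFieldType) (V : vertexAlgebra K).
Implicit Types (x y : V) (n : int) (p : bool).

Lemma vprod_addl n x x' y : vprod n (x + x') y = vprod n x y + vprod n x' y.
Proof. by have := vprod_linearl n 1 x x' y; rewrite !scale1r. Qed.
Lemma vprod_addr n x y y' : vprod n x (y + y') = vprod n x y + vprod n x y'.
Proof. by have := vprod_linearr n 1 x y y'; rewrite !scale1r. Qed.
Lemma vprod0l n y : vprod n 0 y = 0.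
Proof. by apply: (addrI (vprod n 0 y)); rewrite -vprod_addl !addr0. Qed.
Lemma vprod0r n x : vprod n x 0 = 0.
Proof. by apply: (addrI (vprod n x 0)); rewrite -vprod_addr !addr0. Qed.
Lemma vprodZl n a x y : vprod n (a *: x) y = a *: vprod n x y.
Proof. by have := vprod_linearl n a x 0 y; rewrite vprod0l !addr0. Qed.
Lemma vprodZr n a x y : vprod n x (a *: y) = a *: vprod n x y.
Proof. by have := vprod_linearr n a x y 0; rewrite vprod0r !addr0. Qed.

Lemma vparD p x y : vpar p x -> vpar p y -> vpar p (x + y).
Proof. by move=> hx hy; rewrite -[x]scale1r; apply: vpar_linear. Qed.
Lemma vparZ p a x : vpar p x -> vpar p (a *: x).
Proof. by move=> hx; rewrite -[_ *: _]addr0; apply: vpar_linear => //; apply: vpar0. Qed.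
Lemma vparN p x : vpar p x -> vpar p (- x).
Proof. by rewrite -scaleN1r; apply: vparZ. Qed.

Lemma vpar_direct2 x0 x1 : vpar false x0 -> vpar true x1 -> x0 + x1 = 0 ->
  x0 = 0 /\ x1 = 0.
Proof.
move=> h0 h1 /eqP; rewrite addr_eq0 => /eqP E.
have z0 : x0 = 0 by apply: vpar_direct => //; rewrite E; apply: vparN.
by split=> //; move/eqP: E; rewrite z0 eq_sym oppr_eq0 => /eqP.
Qed.

Lemma der_vac e (D : derivation V e) : D (vac V) = 0.
Proof.
have := der_leibniz D (-1) (vac V) (vpar_vac V).
rewrite andbF expr0 scale1r !vvacl vvacr1 eqxx => E.
by apply: (addrI (D (vac V))); rewrite addr0 -E.
Qed.

Lemma der_sum_eq0 e (D : derivation V e) x0 x1 :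
  vpar false x0 -> vpar true x1 -> D (x0 + x1) = 0 -> D x0 = 0 /\ D x1 = 0.
Proof.
move=> /(der_par D) h0 /(der_par D) h1; rewrite linearD /=.
case: e D h0 h1 => D h0 h1 E; last exact: vpar_direct2.
by have [] := vpar_direct2 h1 h0 (etrans (addrC _ _) E).
Qed.

Lemma der_prod_eq0 e (D : derivation V e) n x y :
  D x = 0 -> D y = 0 -> D (vprod n x y) = 0.
Proof.
have [x0 [x1 [h0 h1 ->]]] := vpar_dec x.
move=> /(der_sum_eq0 h0 h1) [D0 D1] Dy.
rewrite vprod_addl linearD /= !(der_leibniz D n y h0, der_leibniz D n y h1).
by rewrite D0 D1 Dy !vprod0l !vprod0r !scaler0 !addr0.
Qed.

Lemma der_prodl e (D : derivation V e) n x y :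
  D y = 0 -> D (vprod n x y) = vprod n (D x) y.
Proof.
have [x0 [x1 [h0 h1 ->]]] := vpar_dec x => Dy.
rewrite vprod_addl !linearD /= !(der_leibniz D n y h0, der_leibniz D n y h1).
by rewrite Dy !vprod0r !scaler0 !addr0 vprod_addl.
Qed.

End Theory.

Record vertex_subalgebra (K : numFieldType) (V : vertexAlgebra K)
    (P : {pred V}) : Prop := VertexSubalgebra {
  vsub_submod : submod_closed P;
  vsub_vac : vac V \in P;
  vsub_prod : forall n x y, x \in P -> y \in P -> vprod n x y \in P;
  vsub_par : forall x0 x1, vpar false x0 -> vpar true x1 -> x0 + x1 \in P ->
    x0 \in P /\ x1 \in P
}.

Record vertex_ideal (K : numFieldType) (V : vertexAlgebra K)
    (I : {pred V}) : Prop := VertexIdeal {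
  vid_submod : submod_closed I;
  vid_prodl : forall n x y, x \in I -> vprod n x y \in I;
  vid_prodr : forall n x y, y \in I -> vprod n x y \in I;
  vid_par : forall x0 x1, vpar false x0 -> vpar true x1 -> x0 + x1 \in I ->
    x0 \in I /\ x1 \in I
}.

Record subva_type (K : numFieldType) (V : vertexAlgebra K) (P : {pred V})
    (HP : vertex_subalgebra P) := SubvaElt {
  subva_val : V; subva_valP : subva_val \in P }.

Section SubVA.
Variables (K : numFieldType) (V : vertexAlgebra K) (P : {pred V}).
Variable HP : vertex_subalgebra P.
Local Notation T := (subva_type HP).

HB.instance Definition _ := [isSub for @subva_val K V P HP].
HB.instance Definition _ := [Choice of T by <:].
HB.instance Definition _ := GRing.SubChoice_isSubLmodule.Build K V P T
  (vsub_submod HP : GRing.subsemimod_closed P).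

Definition subva_par p (x : T) := vpar p (subva_val x).
Definition subva_vac : T := SubvaElt HP (vsub_vac HP).
Definition subva_prod n (x y : T) : T :=
  SubvaElt HP (vsub_prod HP n (subva_valP x) (subva_valP y)).

Lemma subva_val_inj (x y : T) : subva_val x = subva_val y -> x = y.
Proof. exact: val_inj. Qed.
Lemma subva_val_linear : linear (@subva_val K V P HP).
Proof. by []. Qed.
Lemma subva_val_sum N (F : 'I_N -> T) :
  subva_val (\sum_j F j) = \sum_j subva_val (F j).
Proof. by apply: (big_morph (@subva_val K V P HP)). Qed.

Lemma subva_dec (x : T) : exists x0 x1,
  [/\ subva_par false x0, subva_par true x1 & x = x0 + x1].
Proof.
have [x0 [x1 [h0 h1 E]]] := vpar_dec (subva_val x).
have := subva_valP x; rewrite E => /(vsub_par HP h0 h1) [P0 P1].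
by exists (SubvaElt HP P0), (SubvaElt HP P1); split=> //; apply: val_inj.
Qed.

Lemma subva_borcherds p q (a b c : T) (m n k : int) :
  subva_par p a -> subva_par q b ->
    exists N0, forall N, (N0 <= N)%N ->
      \sum_(j < N) gbin K m j *:
          subva_prod (m + k - j%:Z) (subva_prod (n + j%:Z) a b) c
      = \sum_(j < N) ((-1) ^+ j * gbin K n j) *:
          (subva_prod (m + n - j%:Z) a (subva_prod (k + j%:Z) b c)
           - ((-1) ^ n * (-1) ^+ (p && q)) *:
               subva_prod (n + k - j%:Z) b (subva_prod (m + j%:Z) a c)).
Proof.
move=> ha hb.
have [N0 HN] := vborcherds (subva_val c) m n k ha hb.
exists N0 => N /HN E; apply: subva_val_inj; rewrite !subva_val_sum.
exact: E.
Qed.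

Definition subVA : vertexAlgebra K.
Proof.
refine (@VertexAlgebra K T subva_par subva_vac subva_prod _ _ subva_dec _ _ _
  _ _ _ _ _ _ subva_borcherds).
- by move=> p; apply: vpar0.
- by move=> p a x y hx hy; apply: vpar_linear.
- by move=> x h0 h1; apply: val_inj; apply: vpar_direct.
- exact: vpar_vac.
- by move=> n p q x y; apply: vpar_prod.
- by move=> n a x x' y; apply: val_inj; apply: vprod_linearl.
- by move=> n a x y y'; apply: val_inj; apply: vprod_linearr.
- move=> x y; have [N HN] := vtrunc (subva_val x) (subva_val y).
  by exists N => n /HN E; apply: val_inj.
- by move=> n y; apply: val_inj; rewrite /= vvacl; case: ifP.
- by move=> n x hn; apply: val_inj; apply: vvacr.
- by move=> x; apply: val_inj; apply: vvacr1.
Defined.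

Definition subva_incl : vaHom subVA V.
Proof.
by refine (@VaHom K subVA V (@subva_val K V P HP) subva_val_linear _ _ _).
Defined.
End SubVA.

Section QuotVA.
Variables (K : numFieldType) (V : vertexAlgebra K) (I : {pred V}).
Variable HI : vertex_ideal I.

Local Lemma I0 : 0 \in I. Proof. exact: (vid_submod HI).1. Qed.
Local Lemma Ilin a x y : x \in I -> y \in I -> a *: x + y \in I.
Proof. exact: (vid_submod HI).2. Qed.
Local Lemma ID x y : x \in I -> y \in I -> x + y \in I.
Proof. by move=> hx; rewrite -[x]scale1r; apply: Ilin. Qed.
Local Lemma IZ a x : x \in I -> a *: x \in I.
Proof. by move=> hx; rewrite -[_ *: _]addr0; apply: Ilin => //; apply: I0. Qed.
Local Lemma IN x : x \in I -> - x \in I.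
Proof. by rewrite -scaleN1r; apply: IZ. Qed.

Definition quot_rel (_ : vertex_ideal I) : rel V := fun x y => x - y \in I.

Lemma quot_rel_equiv : equiv_class_of (quot_rel HI).
Proof.
split=> [x|x y|y x z]; rewrite /quot_rel.
- by rewrite subrr I0.
- by apply/idP/idP => /IN; rewrite opprB.
- by move=> h1 h2; rewrite -[x](subrK y) -addrA; apply: ID.
Qed.

Definition quot_rel_equivRel := EquivRelPack quot_rel_equiv.

Definition quotva_type : Type := {eq_quot quot_rel_equivRel}%qT.
HB.instance Definition _ := EqQuotient.on quotva_type.
HB.instance Definition _ := Choice.on quotva_type.
Local Notation T := quotva_type.

Definition quotva_pi (x : V) : T := \pi_T%qT x.
Definition quotva_repr (u : T) : V := repr u.
Local Notation pi := quotva_pi.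
Local Notation rp := quotva_repr.

Lemma quotva_reprK u : pi (rp u) = u.
Proof. exact: reprK. Qed.
Lemma quotva_piP x y : (pi x = pi y) <-> (x - y \in I).
Proof.
by split=> [/eqquotP|h]; [|apply/eqquotP].
Qed.
Lemma quotva_repr_pi x : rp (pi x) - x \in I.
Proof. by apply/quotva_piP; rewrite quotva_reprK. Qed.

Definition quotva_zero : T := pi 0.
Definition quotva_opp (u : T) : T := pi (- rp u).
Definition quotva_add (u v : T) : T := pi (rp u + rp v).
Definition quotva_scale (a : K) (u : T) : T := pi (a *: rp u).

Local Lemma piN x : quotva_opp (pi x) = pi (- x).
Proof. by apply/quotva_piP; rewrite -opprD; apply/IN/quotva_repr_pi. Qed.
Local Lemma piD x y : quotva_add (pi x) (pi y) = pi (x + y).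
Proof.
by apply/quotva_piP; rewrite opprD addrACA; apply: ID; apply: quotva_repr_pi.
Qed.
Local Lemma piZ a x : quotva_scale a (pi x) = pi (a *: x).
Proof. by apply/quotva_piP; rewrite -scalerBr; apply/IZ/quotva_repr_pi. Qed.

Lemma quotva_ind (Q : T -> Prop) : (forall x, Q (pi x)) -> forall u, Q u.
Proof. by move=> h u; rewrite -(quotva_reprK u). Qed.

Local Lemma addA : associative quotva_add.
Proof.
elim/quotva_ind=> x; elim/quotva_ind=> y; elim/quotva_ind=> z.
by rewrite !piD addrA.
Qed.
Local Lemma addC : commutative quotva_add.
Proof. by elim/quotva_ind=> x; elim/quotva_ind=> y; rewrite !piD addrC. Qed.
Local Lemma add0 : left_id quotva_zero quotva_add.
Proof. by elim/quotva_ind=> x; rewrite piD add0r. Qed.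
Local Lemma addN : left_inverse quotva_zero quotva_opp quotva_add.
Proof. by elim/quotva_ind=> x; rewrite piN piD addNr. Qed.
HB.instance Definition _ := GRing.isZmodule.Build T addA addC add0 addN.

Local Lemma scaleA a b u :
  quotva_scale a (quotva_scale b u) = quotva_scale (a * b) u.
Proof. by elim/quotva_ind: u => x; rewrite !piZ scalerA. Qed.
Local Lemma scale1 : left_id 1 quotva_scale.
Proof. by elim/quotva_ind=> x; rewrite piZ scale1r. Qed.
Local Lemma scaleDr : right_distributive quotva_scale +%R.
Proof.
move=> a; elim/quotva_ind=> x; elim/quotva_ind=> y.
by rewrite [_ + _]piD !piZ scalerDr [RHS]piD.
Qed.
Local Lemma scaleDl u : {morph quotva_scale^~ u : a b / a + b}.
Proof.
by move=> a b; elim/quotva_ind: u => x; rewrite !piZ [RHS]piD scalerDl.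
Qed.
HB.instance Definition _ :=
  GRing.Zmodule_isLmodule.Build K T scaleA scale1 scaleDr scaleDl.

Lemma quotva_pi_linear : linear quotva_pi.
Proof.
move=> a x y; have -> : a *: pi x = pi (a *: x) by exact: piZ.
exact/esym/piD.
Qed.
HB.instance Definition _ :=
  GRing.isLinear.Build K V T _ quotva_pi quotva_pi_linear.

Lemma quotva_pi_eq0 x : (pi x = 0) <-> (x \in I).
Proof. by rewrite -[0]/(pi 0) quotva_piP subr0. Qed.

Definition quotva_par p (u : T) := exists2 x, vpar p x & pi x = u.
Definition quotva_vac : T := pi (vac V).
Definition quotva_prod n (u v : T) : T := pi (vprod n (rp u) (rp v)).

Lemma quotva_prod_pi n x y : quotva_prod n (pi x) (pi y) = pi (vprod n x y).
Proof.
apply/quotva_piP; rewrite -[rp (pi x)](subrK x) -[rp (pi y)](subrK y).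
rewrite vprod_addl [vprod n x (_ + _)]vprod_addr addrA addrK.
by apply: ID; [apply: (vid_prodl HI)|apply: (vid_prodr HI)];
  apply: quotva_repr_pi.
Qed.

Lemma quotva_par_direct u : quotva_par false u -> quotva_par true u -> u = 0.
Proof.
move=> [x hx <-] [y hy /esym E]; apply/quotva_pi_eq0.
have /(vid_par HI hx (vparN hy)) [] // : x + - y \in I.
exact/quotva_piP.
Qed.

Lemma quotva_borcherds p q (a b c : T) (m n k : int) :
  quotva_par p a -> quotva_par q b ->
    exists N0, forall N, (N0 <= N)%N ->
      \sum_(j < N) gbin K m j *:
          quotva_prod (m + k - j%:Z) (quotva_prod (n + j%:Z) a b) c
      = \sum_(j < N) ((-1) ^+ j * gbin K n j) *:
          (quotva_prod (m + n - j%:Z) a (quotva_prod (k + j%:Z) b c)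
           - ((-1) ^ n * (-1) ^+ (p && q)) *:
               quotva_prod (n + k - j%:Z) b (quotva_prod (m + j%:Z) a c)).
Proof.
move=> [x hx <-] [y hy <-]; elim/quotva_ind: c => z.
have [N0 HN] := vborcherds z m n k hx hy.
exists N0 => N /HN /(congr1 pi); rewrite !linear_sum /= => E.
apply: etrans (etrans E _); apply: eq_bigr => j _.
  by rewrite !quotva_prod_pi [RHS]linearZ.
rewrite !quotva_prod_pi [LHS]linearZ /= linearB; congr (_ *: (_ - _)).
exact: linearZ.
Qed.

Definition quotVA : vertexAlgebra K.
Proof.
refine (@VertexAlgebra K T quotva_par quotva_vac quotva_prod _ _ _
  quotva_par_direct _ _ _ _ _ _ _ _ quotva_borcherds).
- by move=> p; exists 0 => //; apply: vpar0.
- move=> p a u v [x hx <-] [y hy <-]; exists (a *: x + y).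
    exact: vpar_linear.
  exact: linearP.
- elim/quotva_ind=> x; have [x0 [x1 [h0 h1 ->]]] := vpar_dec x.
  by exists (pi x0), (pi x1); split; [exists x0|exists x1|apply: linearD].
- by exists (vac V) => //; apply: vpar_vac.
- move=> n p q u v [x hx <-] [y hy <-]; exists (vprod n x y).
    exact: vpar_prod.
  by rewrite quotva_prod_pi.
- move=> n a; elim/quotva_ind=> x; elim/quotva_ind=> x'; elim/quotva_ind=> y.
  by rewrite -linearP !quotva_prod_pi vprod_linearl linearP.
- move=> n a; elim/quotva_ind=> x; elim/quotva_ind=> y; elim/quotva_ind=> y'.
  by rewrite -linearP !quotva_prod_pi vprod_linearr linearP.
- elim/quotva_ind=> x; elim/quotva_ind=> y; have [N HN] := vtrunc x y.
  by exists N => n /HN; rewrite quotva_prod_pi => ->; apply: linear0.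
- move=> n; elim/quotva_ind=> y; rewrite quotva_prod_pi vvacl.
  by case: ifP => // _; apply: linear0.
- by move=> n; elim/quotva_ind=> x hn; rewrite quotva_prod_pi vvacr ?linear0.
- by elim/quotva_ind=> x; rewrite quotva_prod_pi vvacr1.
Defined.

Definition quotva_proj : vaHom V quotVA.
Proof.
refine (@VaHom K V quotVA quotva_pi quotva_pi_linear _ _ _) => //.
- by move=> p x hx; exists x.
- by move=> n x y; rewrite /= quotva_prod_pi.
Defined.
End QuotVA.

Section Restrict.
Variables (K : numFieldType) (V : vertexAlgebra K) (e : bool).
Variable D : derivation V e.

Definition subva_der (P : {pred V}) (HP : vertex_subalgebra P)
  (DP : forall x, x \in P -> D x \in P) : derivation (subVA HP) e.
Proof.
refine (@Derivation K (subVA HP) e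
  (fun x => SubvaElt HP (DP _ (subva_valP x))) _ _ _).
- by move=> a x y; apply: val_inj; apply: (linearP D).
- by move=> p x hx; exact: (der_par D hx).
- by move=> n p x y hx; apply: val_inj; apply: der_leibniz.
Defined.

Lemma quotva_der_subproof (I : {pred V}) (HI : vertex_ideal I)
  (DI : forall x, x \in I -> D x \in I) x :
  quotva_pi HI (D (quotva_repr (quotva_pi HI x))) = quotva_pi HI (D x).
Proof. by apply/quotva_piP; rewrite -linearB; apply/DI/quotva_repr_pi. Qed.

Definition quotva_der (I : {pred V}) (HI : vertex_ideal I)
  (DI : forall x, x \in I -> D x \in I) : derivation (quotVA HI) e.
Proof.
refine (@Derivation K (quotVA HI) e
  (fun u => quotva_pi HI (D (quotva_repr u))) _ _ _).
- move=> a; elim/quotva_ind=> x; elim/quotva_ind=> y.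
  by rewrite -linearP !(quotva_der_subproof HI DI) -linearP -linearP.
- move=> p u [x hx <-]; rewrite (quotva_der_subproof HI DI).
  by exists (D x) => //; exact: der_par.
- move=> n p u v [x hx <-]; elim/quotva_ind: v => y /=.
  rewrite quotva_prod_pi !(quotva_der_subproof HI DI) !quotva_prod_pi (der_leibniz D n y hx).
  by rewrite linearD; congr (_ + _); exact: linearZ.
Defined.

Lemma quotva_der_pi (I : {pred V}) (HI : vertex_ideal I)
  (DI : forall x, x \in I -> D x \in I) x :
  quotva_der HI DI (quotva_proj HI x) = quotva_proj HI (D x) :> quotVA HI.
Proof. exact: quotva_der_subproof. Qed.

Definition ker_pred : {pred V} := [pred x | D x == 0].

Lemma ker_subalgebra : vertex_subalgebra ker_pred.
Proof.
split.
- split=> [|a x y]; rewrite !inE; first by rewrite linear0.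
  by move=> /eqP hx /eqP hy; rewrite linearP /= hx hy scaler0 addr0.
- by rewrite inE der_vac.
- by move=> n x y; rewrite !inE => /eqP hx /eqP hy; apply/eqP/der_prod_eq0.
- move=> x0 x1 h0 h1; rewrite !inE => /eqP /(der_sum_eq0 h0 h1).
  by case=> -> ->.
Qed.

Definition kerVA : vertexAlgebra K := subVA ker_subalgebra.

Lemma kerVA_eq0 (x : kerVA) : D (subva_val x) = 0.
Proof. exact/eqP/(subva_valP x). Qed.
End Restrict.

Record dgVA (K : numFieldType) := DgVA {
  dg_va :> vertexAlgebra K;
  dg_d : derivation dg_va true;
  dg_sq0 : forall x, dg_d (dg_d x) = 0
}.

Record dgHom (K : numFieldType) (A B : dgVA K) := DgHom {
  dgh_hom :> vaHom A B;
  dgh_comm : forall x, dgh_hom (dg_d A x) = dg_d B (dgh_hom x)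
}.

Section Cohomology.
Variables (K : numFieldType) (A : dgVA K).
Local Notation d := (dg_d A).
Local Notation Z := (kerVA d).

Definition im_pred : {pred Z} := fun x => `[< exists y, subva_val x = d y >].

Lemma im_predP (x : Z) : reflect (exists y, subva_val x = d y) (x \in im_pred).
Proof. exact: asboolP. Qed.

Local Lemma im_add (x y : Z) :
  x \in im_pred -> y \in im_pred -> x + y \in im_pred.
Proof.
move=> /im_predP [w hw] /im_predP [w' hw']; apply/im_predP.
by exists (w + w'); rewrite linearD /= -hw -hw'.
Qed.

Lemma im_ideal : vertex_ideal im_pred.
Proof.
split.
- split=> [|a x y].
    by apply/im_predP; exists 0; rewrite linear0.
  move=> /im_predP [w hw] /im_predP [w' hw']; apply/im_predP.
  by exists (a *: w + w'); rewrite linearP /= -hw -hw'.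
- move=> n x y /im_predP [w hw]; apply/im_predP.
  exists (vprod n w (subva_val y)); rewrite der_prodl ?kerVA_eq0 //.
  by rewrite -hw.
- move=> n x y /im_predP [w hw].
  have [x0 [x1 [h0 h1 ->]]] := vpar_dec x.
  rewrite vprod_addl; apply: im_add; apply/im_predP.
    exists (vprod n (subva_val x0) w).
    by rewrite (der_leibniz d _ _ h0) kerVA_eq0 vprod0l add0r scale1r -hw.
  exists (- vprod n (subva_val x1) w).
  rewrite linearN /= (der_leibniz d _ _ h1) kerVA_eq0 vprod0l add0r.
  by rewrite scaleN1r opprK -hw.
- move=> x0 x1 h0 h1 /im_predP [w hw].
  have [w0 [w1 [k0 k1 E]]] := vpar_dec w.
  have p0 : vpar true (d w0) by exact: (der_par d k0).
  have p1 : vpar false (d w1) by exact: (der_par d k1).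
  have {}h0 : vpar false (subva_val x0) by exact: h0.
  have {}h1 : vpar true (subva_val x1) by exact: h1.
  have {}hw : subva_val x0 + subva_val x1 = d w1 + d w0.
    by rewrite [RHS]addrC; move: hw; rewrite E linearD.
  have /(vpar_direct2 (vparD h0 (vparN p1)) (vparD h1 (vparN p0))) :
      (subva_val x0 - d w1) + (subva_val x1 - d w0) = 0.
    by rewrite addrACA hw -opprD subrr.
  case=> /eqP; rewrite subr_eq0 => /eqP e0 /eqP; rewrite subr_eq0 => /eqP e1.
  by split; apply/im_predP; [exists w1|exists w0].
Qed.

Definition cohVA : vertexAlgebra K := quotVA im_ideal.

Definition coh_class (x : Z) : cohVA := quotva_pi im_ideal x.
End Cohomology.

Arguments coh_class {K A}.

Section CohomologyMap.
Variables (K : numFieldType) (A B : dgVA K) (f : dgHom A B).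

Lemma ker_map_subproof (x : kerVA (dg_d A)) :
  f (subva_val x) \in ker_pred (dg_d B).
Proof. by rewrite inE -dgh_comm kerVA_eq0 linear0. Qed.

Definition ker_map (x : kerVA (dg_d A)) : kerVA (dg_d B) :=
  SubvaElt (ker_subalgebra (dg_d B)) (ker_map_subproof x).

Definition coh_map (u : cohVA A) : cohVA B :=
  coh_class (ker_map (quotva_repr u)).

Lemma coh_mapE x : coh_map (coh_class x) = coh_class (ker_map x).
Proof.
apply/quotva_piP/im_predP.
have /im_predP [y hy] := quotva_repr_pi (im_ideal A) x.
exists (f y); rewrite -dgh_comm -hy [subva_val (_ - _)]/=.
by rewrite -linearB.
Qed.

Definition quasi_iso : Prop := bijective coh_map.
End CohomologyMap.

Record bidifferential (K : numFieldType) (V : vertexAlgebra K) :=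
  Bidifferential {
  Qminus : derivation V true;
  Qplus : derivation V true;
  Qminus_sq0 : forall x, Qminus (Qminus x) = 0;
  Qplus_sq0 : forall x, Qplus (Qplus x) = 0;
  Q_anticomm : forall x, Qminus (Qplus x) + Qplus (Qminus x) = 0
}.

Section Bidifferential.
Variables (K : numFieldType) (V : vertexAlgebra K) (Q : bidifferential V).

Definition QmQp_lemma : Prop := forall x : V,
  Qminus Q x = 0 -> Qplus Q x = 0 ->
  (exists x', x = Qminus Q x' \/ x = Qplus Q x') ->
  exists xt, x = Qminus Q (Qplus Q xt).

Definition minus_dg : dgVA K := DgVA (@Qminus_sq0 K V Q).
Definition plus_dg : dgVA K := DgVA (@Qplus_sq0 K V Q).

Lemma Qminus_ker x : x \in ker_pred (Qplus Q) -> Qminus Q x \in ker_pred (Qplus Q).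
Proof.
rewrite !inE => /eqP hx; have := Q_anticomm Q x.
by rewrite hx linear0 add0r => ->.
Qed.

Definition Qminus_res : derivation (kerVA (Qplus Q)) true :=
  subva_der (ker_subalgebra (Qplus Q)) Qminus_ker.

Lemma Qminus_res_sq0 x : Qminus_res (Qminus_res x) = 0.
Proof. by apply: val_inj; apply: Qminus_sq0. Qed.

Definition kerplus_dg : dgVA K := DgVA Qminus_res_sq0.

Lemma Qminus_im (x : kerVA (Qplus Q)) :
  x \in im_pred (A := plus_dg) -> Qminus_res x \in im_pred (A := plus_dg).
Proof.
move=> /im_predP [y hy]; apply/im_predP; exists (- Qminus Q y).
have := Q_anticomm Q y; rewrite linearN => /eqP.
by rewrite addr_eq0 => /eqP <-; rewrite /= hy.
Qed.

Definition Qminus_ind : derivation (cohVA plus_dg) true :=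
  quotva_der (im_ideal plus_dg) Qminus_im.

Lemma Qminus_ind_class x :
  Qminus_ind (coh_class x) = coh_class (A := plus_dg) (Qminus_res x).
Proof. exact: quotva_der_pi. Qed.

Lemma Qminus_ind_sq0 u : Qminus_ind (Qminus_ind u) = 0.
Proof.
elim/quotva_ind: u => x.
by rewrite !Qminus_ind_class Qminus_res_sq0; apply: linear0.
Qed.

Definition cohplus_dg : dgVA K := DgVA Qminus_ind_sq0.

Definition incl_kerplus : dgHom kerplus_dg minus_dg.
Proof.
by refine (@DgHom K kerplus_dg minus_dg
  (subva_incl (ker_subalgebra (Qplus Q))) _).
Defined.

Definition proj_cohplus : dgHom kerplus_dg cohplus_dg.
Proof.
refine (@DgHom K kerplus_dg cohplus_dg (quotva_proj (im_ideal plus_dg)) _).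
by move=> x; apply/esym/Qminus_ind_class.
Defined.
End Bidifferential.

(* A tensor product of vertex algebras: the underlying space satisfies the
   universal property of the tensor product of vector spaces, and
   Y(a (x) b, z) (c (x) d)
     = (-1)^{p(b) p(c)} (Y(a, z) c) (x) (Y(b, z) d). *)
Record tensorVA (K : numFieldType) (V1 V2 : vertexAlgebra K) := TensorVA {
  ten_va :> vertexAlgebra K;
  ten : V1 -> V2 -> ten_va;
  ten_linearl : forall y, linear (fun x => ten x y);
  ten_linearr : forall x, linear (ten x);
  ten_universal : forall (U : lmodType K) (h : V1 -> V2 -> U),
    (forall y, linear (fun x => h x y)) -> (forall x, linear (h x)) ->
    exists f : ten_va -> U,
      [/\ linear f, forall x y, f (ten x y) = h x y
        & forall f' : ten_va -> U, linear f' ->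
            (forall x y, f' (ten x y) = h x y) -> forall w, f' w = f w];
  ten_par : forall p q x y, vpar p x -> vpar q y -> vpar (p (+) q) (ten x y);
  ten_vac : vac ten_va = ten (vac V1) (vac V2);
  ten_prod : forall n p q a b c d, vpar p b -> vpar q c ->
    vprod n (ten a b) (ten c d)
    = (-1) ^+ (p && q) *:
      \sum_(i \in [set: int]) ten (vprod i a c) (vprod (n - 1 - i) b d)
}.

Section FreelyGenerated.
Variables (K : numFieldType) (V : vertexAlgebra K) (I : finType).
Variables (odd : bool) (gen : I -> V).

(* The word (n_1, i_1) ... (n_k, i_k) stands for the state
   (gen i_1)_(-n_1-1) ... (gen i_k)_(-n_k-1) |0>. Ordered words may repeat a
   letter only when the generators are even. *)
Definition pbw_monomial (w : seq (nat * I)) : V :=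
  foldr (fun l v => vprod (- l.1.+1%:Z) (gen l.2) v) (vac V) w.

Definition pbw_le (l l' : nat * I) : bool :=
  (l.1 < l'.1)%N || (l.1 == l'.1) &&
  (if odd then enum_rank l.2 < enum_rank l'.2
   else enum_rank l.2 <= enum_rank l'.2)%N.

Definition pbw_ordered (w : seq (nat * I)) : bool := sorted pbw_le w.

Definition freely_generated : Prop :=
  (forall i, vpar odd (gen i)) /\
  (forall v : V, exists (ws : seq (seq (nat * I))) (c : seq (nat * I) -> K),
     all pbw_ordered ws /\ v = \sum_(w <- ws) c w *: pbw_monomial w) /\
  (forall (ws : seq (seq (nat * I))) (c : seq (nat * I) -> K),
     uniq ws -> all pbw_ordered ws ->
     \sum_(w <- ws) c w *: pbw_monomial w = 0 ->
     forall w, w \in ws -> c w = 0).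
End FreelyGenerated.

Record lieAlgebra (F : fieldType) := LieAlgebra {
  lie_sort :> vectType F;
  lie_br : lie_sort -> lie_sort -> lie_sort;
  lie_linearl : forall y, linear (fun x => lie_br x y);
  lie_alt : forall x, lie_br x x = 0;
  lie_jacobi : forall x y z,
    lie_br x (lie_br y z) + lie_br y (lie_br z x) + lie_br z (lie_br x y) = 0
}.

Arguments lie_br {F l}.

(* Every compact Lie group has a faithful matrix representation, so it is
   enough to consider compact matrix groups; the Lie algebra of such a group
   consists of the velocities at 0 of its one-parameter subgroups. *)
Definition compact_matrix_group (R : realType) N (H : set 'M[R]_N) : Prop :=
  [/\ compact H, H 1%:M,
      forall a b, H a -> H b -> H (a *m b)
    & forall a, H a -> a \in unitmx /\ H (invmx a)].

Definition matrix_group_lie (R : realType) N (H : set 'M[R]_N) : set 'M[R]_N :=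
  [set X | exists gam : R -> 'M[R]_N,
    [/\ forall t, H (gam t), forall s t, gam (s + t) = gam s *m gam t
      & forall i j, is_derive (0 : R) (1 : R) (fun t => gam t i j) (X i j)]].

Definition lie_of_compact_group (R : realType) (g : lieAlgebra R) : Prop :=
  exists (N : nat) (H : set 'M[R]_N) (rho : g -> 'M[R]_N),
    [/\ compact_matrix_group H, linear rho, injective rho,
        forall x y, rho (lie_br x y) = rho x *m rho y - rho y *m rho x
      & range rho = matrix_group_lie H].

Section Factors.
Variables (F : fieldType) (g : lieAlgebra F).

Definition lie_ideal (s : {vspace g}) : Prop :=
  forall x y, y \in s -> lie_br x y \in s.

Definition simple_factor (s : {vspace g}) : Prop :=
  [/\ lie_ideal s,
      exists x y, [/\ x \in s, y \in s & lie_br x y != 0]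
    & forall i : {vspace g}, lie_ideal i -> (i <= s)%VS -> i = 0%VS \/ i = s].

Definition lie_central (x : g) : Prop := forall y, lie_br x y = 0.

(* The trace of (ad x) (ad y). *)
Definition killing (x y : g) : F :=
  \sum_(i < \dim {: g})
     coord (vbasis {: g}) i (lie_br x (lie_br y (vbasis {: g})`_i)).

(* The structure constants f_{AB}^C of a basis T. *)
Definition lie_struct d (T : d.-tuple g) (A B C : 'I_d) : F :=
  coord T C (lie_br T`_A T`_B).
End Factors.

Section LongRoots.
Variables (R : realType) (g : lieAlgebra R) (d : nat) (T : d.-tuple g).
Variable kap : g -> g -> R.

(* The complexification of g, in the coordinates given by T, with the
   complex-bilinear extensions of the bracket and of kap. *)
Local Notation gC := 'rV[R[i]]_d.

Definition cembed (x : g) : gC := \row_A (coord T A x)%:C.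

Definition cbr (x y : gC) : gC :=
  \row_C \sum_A \sum_B x 0 A * y 0 B * (lie_struct T A B C)%:C.

Definition ckap (x y : gC) : R[i] :=
  \sum_A \sum_B x 0 A * y 0 B * (kap T`_A T`_B)%:C.

Definition cartan (s t : {vspace g}) : Prop :=
  [/\ (t <= s)%VS, forall x y, x \in t -> y \in t -> lie_br x y = 0
    & forall x, x \in s -> (forall h, h \in t -> lie_br h x = 0) -> x \in t].

(* alp is only considered on t, where it is automatically linear. *)
Definition is_root (t : {vspace g}) (alp : g -> R[i]) : Prop :=
  (exists2 h, h \in t & alp h != 0) /\
  (exists2 x : gC, x != 0 &
     forall h, h \in t -> cbr (cembed h) x = alp h *: x).

(* ta is the element of the complexification of t representing alp, so that
   the squared length of alp is ckap ta ta. *)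
Definition root_dual (t : {vspace g}) (alp : g -> R[i]) (ta : gC) : Prop :=
  (exists t1 t2, [/\ t1 \in t, t2 \in t & ta = cembed t1 + 'i *: cembed t2]) /\
  (forall h, h \in t -> ckap ta (cembed h) = alp h).

Definition long_roots_sqlen2 (s : {vspace g}) : Prop :=
  forall t, cartan s t ->
    (forall alp ta, is_root t alp -> root_dual t alp ta -> ckap ta ta <= 2) /\
    (exists alp ta, [/\ is_root t alp, root_dual t alp ta & ckap ta ta = 2]).
End LongRoots.

(* [ga_hv s] is the dual Coxeter number of the simple factor s: the Killing
   form of s is 2 h^vee times the normalized one. In particular the normalized
   form of s is proportional to the Killing form. *)
Record gaugeAlgebra (R : realType) := GaugeAlgebra {
  ga_lie :> lieAlgebra R;
  ga_compact : lie_of_compact_group ga_lie;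
  ga_dim : nat;
  ga_T : ga_dim.-tuple ga_lie;
  ga_basis : basis_of fullv ga_T;
  ga_kap : ga_lie -> ga_lie -> R;
  ga_kap_linear : forall y, linear (fun x => ga_kap x y : R^o);
  ga_kap_sym : forall x y, ga_kap x y = ga_kap y x;
  ga_kap_inv : forall x y z, ga_kap (lie_br x y) z = ga_kap x (lie_br y z);
  ga_kap_nondeg : forall x, (forall y, ga_kap x y = 0) -> x = 0;
  ga_kap_norm : forall s, simple_factor s -> long_roots_sqlen2 ga_T ga_kap s;
  ga_hv : {vspace ga_lie} -> R;
  ga_hvP : forall s, simple_factor s -> forall x y, x \in s -> y \in s ->
    killing x y = 2 * ga_hv s * ga_kap x y
}.

Section Gauge.
Variables (R : realType) (g : gaugeAlgebra R).
Local Notation d := (ga_dim g).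
Local Notation C := R[i].

Definition ga_f (A B D : 'I_d) : R := lie_struct (ga_T g) A B D.
Definition ga_K : 'M[R]_d := \matrix_(A, B) ga_kap (ga_T g)`_A (ga_T g)`_B.
Definition ga_Kinv : 'M[R]_d := invmx ga_K.
Definition ga_flow (A B E : 'I_d) : R := \sum_D ga_f A B D * ga_K D E.

(* The level is k s on the simple factor s and 0 on the centre; [affine_J x]
   is the field of an arbitrary element x of g. *)
Definition affine_J (V : vertexAlgebra C) (J : 'I_d -> V) (x : g) : V :=
  \sum_A (coord (ga_T g) A x)%:C *: J A.

Record universalAffine (k : {vspace g} -> R) := UniversalAffine {
  ua_va :> vertexAlgebra C;
  ua_J : 'I_d -> ua_va;
  ua_free : freely_generated false ua_J;
  ua_ope0 : forall A B,
    vprod 0 (ua_J A) (ua_J B) = \sum_D (ga_f A B D)%:C *: ua_J D;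
  ua_ope1_simple : forall s x y, simple_factor s -> x \in s ->
    vprod 1 (affine_J ua_J x) (affine_J ua_J y)
    = (k s * ga_kap x y)%:C *: vac ua_va;
  ua_ope1_center : forall x y, lie_central x ->
    vprod 1 (affine_J ua_J x) (affine_J ua_J y) = 0;
  ua_ope2 : forall n A B, 2 <= n -> vprod n (ua_J A) (ua_J B) = 0
}.

Definition minus2h_level (s : {vspace g}) : R := - (2 * ga_hv s).

(* The index [true] stands for + and [false] for -. *)
Definition eps (a b : bool) : C := (a && ~~ b)%:R - (~~ a && b)%:R.

Record symplecticFermions := SymplecticFermions {
  sf_va :> vertexAlgebra C;
  sf_eta : bool -> 'I_d -> sf_va;
  sf_free : freely_generated true (fun l : bool * 'I_d => sf_eta l.1 l.2);
  sf_comm : forall a b A B (n m : int) x,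
    vprod n (sf_eta a A) (vprod m (sf_eta b B) x)
    + vprod m (sf_eta b B) (vprod n (sf_eta a A) x)
    = (n%:~R * eps a b * (ga_Kinv A B)%:C * (n + m == 0)%:R) *: x
}.

Section ZeroMode.
Variables (K : numFieldType) (V : vertexAlgebra K).

Lemma gbin00 : gbin K 0 0 = 1.
Proof. by rewrite /gbin big_ord0 fact0 divr1. Qed.

Lemma gbin0S j : (0 < j)%N -> gbin K 0 j = 0.
Proof. by case: j => // j _; rewrite /gbin big_ord_recl /= subrr mul0r mul0r. Qed.

Lemma sum_gbin0 (N : nat) (c : nat -> K) (F : nat -> V) :
  \sum_(j < N.+1) (c j * gbin K 0 j) *: F j = c 0%N *: F 0%N.
Proof.
rewrite big_ord_recl /= gbin00 mulr1 big1 ?addr0 // => i _.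
by rewrite gbin0S // mulr0 scale0r.
Qed.

Lemma zero_mode_leibniz (a : V) n p x y : vpar false a -> vpar p x ->
  vprod 0 a (vprod n x y)
  = vprod n (vprod 0 a x) y + vprod n x (vprod 0 a y).
Proof.
move=> ha hx; have [N0 HN] := vborcherds y 0 0 n ha hx.
have := HN N0.+1 (leqW (leqnn _)).
under eq_bigr do rewrite -[gbin _ _ _]mul1r.
rewrite (sum_gbin0 _ (fun=> 1) (fun j => vprod (0 + n - j%:Z) (vprod (0 + j%:Z) a x) y)).
rewrite (sum_gbin0 _ (fun j => (-1) ^+ j) (fun j =>
  vprod (0 + 0 - j%:Z) a (vprod (n + j%:Z) x y)
  - ((-1) ^ (0 : int) * (-1) ^+ (false && p)) *:
    vprod (0 + n - j%:Z) x (vprod (0 + j%:Z) a y))).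
rewrite /= !expr0 expr0z !mul1r !scale1r !subr0 ?addr0 !add0r => ->.
by rewrite subrK.
Qed.

Definition zero_mode (a : V) (ha : vpar false a) : derivation V false.
Proof.
refine (@Derivation K V false (vprod 0 a) _ _ _).
- by move=> c x y; apply: vprod_linearr.
- by move=> p x; apply: vpar_prod.
- move=> n p x y hx; rewrite expr0 scale1r; exact: (zero_mode_leibniz n y ha hx).
Defined.

Definition der_add e (D D' : derivation V e) : derivation V e.
Proof.
refine (@Derivation K V e (fun x => D x + D' x) _ _ _).
- by move=> c x y; rewrite !linearP /= scalerDr addrACA.
- by move=> p x hx; apply: vparD; apply: der_par.
- move=> n p x y hx; rewrite (der_leibniz D n y hx) (der_leibniz D' n y hx).
  by rewrite addrACA vprod_addl vprod_addr scalerDr.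
Defined.

Definition ker_all_pred (J : finType) e (D : J -> derivation V e) : {pred V} :=
  [pred x | [forall j, D j x == 0]].

Lemma ker_all_subalgebra (J : finType) e (D : J -> derivation V e) :
  vertex_subalgebra (ker_all_pred D).
Proof.
split.
- split=> [|a x y]; rewrite !inE; first by apply/forallP=> j; rewrite linear0.
  move=> /forallP hx /forallP hy; apply/forallP=> j.
  by rewrite linearP /= (eqP (hx j)) (eqP (hy j)) scaler0 addr0.
- by rewrite inE; apply/forallP=> j; rewrite der_vac.
- move=> n x y; rewrite !inE => /forallP hx /forallP hy; apply/forallP=> j.
  by apply/eqP/der_prod_eq0; apply/eqP.
- move=> x0 x1 h0 h1; rewrite !inE => /forallP h.
  by split; apply/forallP=> j; have [] := der_sum_eq0 h0 h1 (eqP (h j)) => e0 e1;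
    apply/eqP.
Qed.
End ZeroMode.

Section Chiral.
Variables (k : {vspace g} -> R) (U : universalAffine k).
Variables (Vm : vertexAlgebra C) (phi : vaHom U Vm).
Variables (S : symplecticFermions) (W : tensorVA Vm S).

Definition JW (A : 'I_d) : W := ten W (phi (ua_J U A)) (vac S).
Definition etaW (a : bool) (A : 'I_d) : W := ten W (vac Vm) (sf_eta S a A).

Lemma JW_even A : vpar false (JW A).
Proof.
apply: (@ten_par _ _ _ W false false); last exact: vpar_vac.
by apply: hom_par; have [h _] := ua_free U; apply: h.
Qed.

Definition is_theta (theta : 'I_d -> derivation W false) : Prop :=
  (forall A v, theta A (ten W v (vac S)) = 0) /\
  (forall A a B, theta A (etaW a B) = - \sum_E (ga_f A E B)%:C *: etaW a E).

Definition is_Lambda (Lam : derivation W false) : Prop :=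
  [/\ forall v, Lam (ten W v (vac S)) = 0,
      forall A, Lam (etaW false A) = etaW true A
    & forall A, Lam (etaW true A) = 0].

Definition gauge_der (theta : 'I_d -> derivation W false) (A : 'I_d) :
  derivation W false := der_add (zero_mode (JW_even A)) (theta A).

Definition chiralVA (theta : 'I_d -> derivation W false) : vertexAlgebra C :=
  subVA (ker_all_subalgebra (gauge_der theta)).

(* Normally ordered product of odd modes: annihilation modes (of index >= 0)
   are moved to the right, with the sign of the permutation. *)
Fixpoint nord (s : seq (int * (W -> W))) (x : W) : W :=
  match s with
  | [::] => x
  | l :: s' => if l.1 < 0 then l.2 (nord s' x)
               else (-1) ^+ size s' *: nord s' (l.2 x)
  end.

Definition eta_mode (a : bool) (A : 'I_d) (n : int) : int * (W -> W) :=
  (n, vprod n (etaW a A)).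

(* On each vector only finitely many terms of the two sums are nonzero. *)
Definition Qminus_op (x : W) : W :=
  \sum_(n \in [set n : int | n != 0])
     (n%:~R)^-1 *: \sum_A vprod (- n) (etaW false A) (vprod n (JW A) x)
  + \sum_(l \in [set l : int * int | [/\ l.1 != 0, l.2 != 0 & l.1 != l.2]])
     (let: (m, n) := l in
      \sum_A \sum_B \sum_E ((ga_flow A B E)%:C / (2 * m%:~R * n%:~R)) *:
        nord [:: eta_mode false A (- n); eta_mode false B m;
                 eta_mode true E (n - m)] x).

Definition Qplus_op (Lam : derivation W false) (x : W) : W :=
  Lam (Qminus_op x) - Qminus_op (Lam x).

(* The formulas for Q^- and Q^+ make sense on the whole of V_matter (x) Sf, but
   define square-zero, anticommuting derivations only on C(g, V_matter). *)
Definition is_QmQp (theta : 'I_d -> derivation W false)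
  (Lam : derivation W false) (Q : bidifferential (chiralVA theta)) : Prop :=
  forall x : chiralVA theta,
    subva_val (Qminus Q x) = Qminus_op (subva_val x) /\
    subva_val (Qplus Q x) = Qplus_op Lam (subva_val x).
End Chiral.
End Gauge.

Arguments minus2h_level {R} g.

(* Main.v *)
Require Import Defs.
From mathcomp Require Import all_boot all_order all_algebra complex.
From mathcomp Require Import all_classical all_reals all_analysis.
Import GRing.Theory.
Local Open Scope ring_scope.

(** This is the argument by which the [d d^c] lemma yields formality, with
    [Q^-] and [Q^+] in the roles of [d] and [d^c]. It only uses that the two
    differentials square to zero, anticommute and satisfy the [Q^- Q^+] lemma, so
    it is carried out for an arbitrary bidifferential vertex algebra
    ([incl_kerplus_quasi_iso] and [proj_cohplus_quasi_iso]).

    Each of the four facts needed (injectivity and surjectivity on cohomology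
    of the inclusion and of the projection) comes from one application of the
    lemma to a vector that is closed for both differentials and exact for one of
    them:
    - a [Q^+]-closed vector [Q^- y] equals [Q^- (Q^+ w)], hence is the
      differential of the [Q^+]-closed vector [Q^+ w];
    - if [Q^- b = 0] then [Q^+ b = Q^- (Q^+ w)] for some [w], and anticommutation
      makes [b + Q^- w] a [Q^+]-closed representative of the class of [b];
    - if [x = Q^- y + Q^+ z] is closed for both and [Q^+ y = 0], then
      [Q^+ z = Q^- (Q^+ w)], so [x = Q^- (y + Q^+ w)];
    - if [Q^+ y = 0] and [Q^- y = Q^+ z] then [Q^- y = Q^- (Q^+ w)] for some [w],
      and [y - Q^+ w] is closed for both, in the [Q^+]-class of [y]. *)

(** The criterion is phrased on vectors rather than on classes, so that no
    representatives of cohomology classes have to be handled afterwards. *)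
Lemma quasi_isoP (K : numFieldType) (A B : dgVA K) (f : dgHom A B) :
  (forall x, dg_d A x = 0 -> (exists y, f x = dg_d B y) ->
     exists w, x = dg_d A w) ->
  (forall b, dg_d B b = 0 ->
     exists2 a, dg_d A a = 0 & exists y, b - f a = dg_d B y) ->
  quasi_iso f.
Proof.
move=> f_inj f_surj.
have inj : injective (coh_map f).
  elim/quotva_ind=> x; elim/quotva_ind=> y.
  rewrite -!/(coh_class _) !coh_mapE => /quotva_piP/im_predP [z Ez].
  apply/quotva_piP/im_predP; apply: f_inj; first exact: kerVA_eq0.
  by exists z; rewrite -Ez [RHS]/= -linearB.
have surj v : exists u, coh_map f u = v.
  elim/quotva_ind: v => b.
  have [a da [y Ey]] := f_surj (subva_val b) (kerVA_eq0 b).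
  have ka : a \in ker_pred (dg_d A) by rewrite inE da.
  exists (coh_class (SubvaElt (ker_subalgebra (dg_d A)) ka)).
  rewrite coh_mapE; apply/quotva_piP/im_predP; exists (- y).
  by rewrite linearN /= -Ey opprB.
have [h hK] := choice surj.
by exists h => // u; apply: inj; rewrite hK.
Qed.

Lemma Qminus_Qplus (K : numFieldType) (V : vertexAlgebra K)
    (Q : bidifferential V) x : Qminus Q (Qplus Q x) = - Qplus Q (Qminus Q x).
Proof. exact/eqP/(etrans (esym (addr_eq0 _ _)))/eqP/Q_anticomm. Qed.

Theorem incl_kerplus_quasi_iso (K : numFieldType) (V : vertexAlgebra K)
    (Q : bidifferential V) (HQ : QmQp_lemma Q) : quasi_iso (incl_kerplus Q).
Proof.
apply: quasi_isoP => [x dx [y Ey]|b db].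
- have [|||w Ew] := HQ (subva_val x).
  + exact: (congr1 (@subva_val _ _ _ (ker_subalgebra (Qplus Q))) dx).
  + exact: kerVA_eq0.
  + by exists y; left.
  have kw : Qplus Q w \in ker_pred (Qplus Q) by rewrite inE Qplus_sq0.
  by exists (SubvaElt (ker_subalgebra (Qplus Q)) kw); apply: val_inj.
- have {}db : Qminus Q b = 0 by exact: db.
  have [|||w Ew] := HQ (Qplus Q b).
  + by rewrite Qminus_Qplus db linear0 oppr0.
  + exact: Qplus_sq0.
  + by exists b; right.
  have ka : b + Qminus Q w \in ker_pred (Qplus Q).
    by rewrite inE linearD /= Ew Qminus_Qplus addNr.
  exists (SubvaElt (ker_subalgebra (Qplus Q)) ka).
    by apply: val_inj; rewrite /= linearD /= db Qminus_sq0 addr0.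
  exists (- w); rewrite linearN /= opprD addrA subrr.
  exact: sub0r.
Qed.

Theorem proj_cohplus_quasi_iso (K : numFieldType) (V : vertexAlgebra K)
    (Q : bidifferential V) (HQ : QmQp_lemma Q) : quasi_iso (proj_cohplus Q).
Proof.
apply: quasi_isoP => [x dx [u]|].
- have {}dx : Qminus Q (subva_val x) = 0.
    exact: (congr1 (@subva_val _ _ _ (ker_subalgebra (Qplus Q))) dx).
  elim/quotva_ind: u => y Ey.
  have /quotva_piP/im_predP [z Ez] :
      coh_class (A := plus_dg Q) x
      = coh_class (A := plus_dg Q) (Qminus_res Q y).
    by rewrite -Qminus_ind_class.
  have {}Ez : subva_val x - Qminus Q (subva_val y) = Qplus Q z by exact: Ez.
  have [|||w Ew] := HQ (Qplus Q z).
  + by rewrite -Ez linearB /= dx Qminus_sq0 subr0.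
  + exact: Qplus_sq0.
  + by exists z; right.
  have kw : subva_val y + Qplus Q w \in ker_pred (Qplus Q).
    by rewrite inE linearD /= Qplus_sq0 (kerVA_eq0 y) addr0.
  exists (SubvaElt (ker_subalgebra (Qplus Q)) kw); apply: val_inj.
  by rewrite /= linearD /= -Ew -Ez addrC subrK.
- elim/quotva_ind=> y dy.
  have /quotva_pi_eq0/im_predP [z Ez] :
      coh_class (A := plus_dg Q) (Qminus_res Q y) = 0.
    by rewrite -Qminus_ind_class.
  have {}Ez : Qminus Q (subva_val y) = Qplus Q z by exact: Ez.
  have [|||w Ew] := HQ (Qminus Q (subva_val y)).
  + exact: Qminus_sq0.
  + by rewrite Ez Qplus_sq0.
  + by exists z; right.
  have ka : subva_val y - Qplus Q w \in ker_pred (Qplus Q).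
    by rewrite inE linearB /= Qplus_sq0 (kerVA_eq0 y) subr0.
  exists (SubvaElt (ker_subalgebra (Qplus Q)) ka).
    by apply: val_inj; rewrite /= linearB /= Ew subrr.
  (* The two [Q^+]-classes agree, so their difference is the differential of 0. *)
  exists 0; rewrite linear0; apply/eqP; rewrite subr_eq0; apply/eqP.
  apply/quotva_piP/im_predP; exists w.
  by rewrite /= opprB addrC subrK.
Qed.

Theorem theorem4p9 (R : realType) (g : gaugeAlgebra R)
    (U : universalAffine (minus2h_level g)) (Vmatter : vertexAlgebra R[i])
    (phi : vaHom U Vmatter)
    (Sf : symplecticFermions g) (W : tensorVA Vmatter Sf)
    (theta : 'I_(ga_dim g) -> derivation W false) (Htheta : is_theta theta)
    (Lam : derivation W false) (HLam : is_Lambda Lam)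
    (Q : bidifferential (chiralVA phi theta)) (HQ : is_QmQp Lam Q)
    (Hlemma : QmQp_lemma Q) :
  quasi_iso (incl_kerplus Q) /\ quasi_iso (proj_cohplus Q).
Proof.
by split; [apply: incl_kerplus_quasi_iso|apply: proj_cohplus_quasi_iso].
Qed.
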